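(* Let $n\ge 1$ and let $(M,\eta,\xi,\phi,g)$ be a $(2n+1)$-dimensional contact metric manifold. Then $M$ is $\phi$-recurrent and of constant curvature if and only if $\dim M=3$ (that is, $n=1$) and $(M,g)$ is flat.
   Context: Manifolds are smooth and non-empty. A contact metric manifold is a $(2n+1)$-dimensional manifold $M$, $n\ge 1$, with a 1-form $\eta$ satisfying $\eta\wedge(d\eta)^n\neq 0$ everywhere, the characteristic vector field $\xi$ (determined by $\eta(\xi)=1$, $d\eta(\xi,\cdot)=0$), a Riemannian metric $g$ and a $(1,1)$-tensor field $\phi$ such that for all vector fields $X,Y$: $\eta(X)=g(X,\xi)$, $d\eta(X,Y)=g(X,\phi Y)$, $\phi^2X=-X+\eta(X)\xi$. Convention: $d\eta(X,Y)=\frac12\big(X\eta(Y)-Y\eta(X)-\eta([X,Y])\big)$. Let $\nabla$ be the Levi-Civita connection of $g$ and $R(X,Y)Z=\nabla_X\nabla_YZ-\nabla_Y\nabla_XZ-\nabla_{[X,Y]}Z$. A contact metric manifold is $\phi$-recurrent if there exists a non-zero 1-form $A$ (i.e. not identically zero) such that $\phi^2((\nabla_WR)(X,Y)Z)=A(W)R(X,Y)Z$ for all vector fields $X,Y,Z,W$ (not necessarily orthogonal to $\xi$). Constant curvature means that there is a real constant $\lambda$ such that $R(X,Y)Z=\lambda(g(Y,Z)X-g(X,Z)Y)$ for all vector fields $X,Y,Z$. Flat means $R=0$. *)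

(* Defs.v *)
From HB Require Import structures.
From mathcomp Require Import all_boot all_order all_algebra all_fingroup.
From mathcomp Require Import boolp classical_sets functions cardinality reals.
From mathcomp Require Import topology normedtype derive.
From mathcomp Require Import ring.

Set Implicit Arguments.
Unset Strict Implicit.
Unset Printing Implicit Defensive.

Import Order.TTheory GRing.Theory Num.Theory.
Import numFieldNormedType.Exports.

Local Open Scope classical_set_scope.
Local Open Scope ring_scope.

Section euclidean_smoothness.
Context (R : realType) (m : nat).
Implicit Types (U : set 'rV[R]_m) (f g : 'rV[R]_m -> R).

Fixpoint Ck_on (k : nat) U f : Prop :=
  {in U, continuous f} /\
  if k is k'.+1 then
    forall i : 'I_m, {in U, forall x, derivable f x 'e_i} /\
      Ck_on k' U (fun x => 'D_'e_i f x)
  else True.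

Definition Cinfty_on U f : Prop := forall k, Ck_on k U f.

Lemma open_in_near U f g x : open U -> {in U, f =1 g} -> x \in U ->
  \forall y \near x, f y = g y.
Proof.
move=> oU fg /set_mem Ux; have : nbhs x U by exact: open_nbhs_nbhs.
by apply: filterS => y Uy; apply: fg; exact: mem_set.
Qed.

Lemma Ck_on_eq k U f g : open U -> {in U, f =1 g} ->
  Ck_on k U f -> Ck_on k U g.
Proof.
move=> oU; elim: k f g => [|k IHk] f g fg [cf df].
  split=> // x Ux; rewrite /continuous_at -(fg x Ux).
  apply: cvg_trans (cf x Ux).
  by apply: near_eq_cvg; [exact: nbhs_filter|exact: (open_in_near oU fg Ux)].
split=> [x Ux|].
  rewrite /continuous_at -(fg x Ux); apply: cvg_trans (cf x Ux).
  by apply: near_eq_cvg; [exact: nbhs_filter|exact: (open_in_near oU fg Ux)].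
move=> i; have [dfi Dfi] := df i; split=> [x Ux|].
  apply: near_eq_derivable (dfi x Ux); exact: (open_in_near oU fg Ux).
apply: IHk Dfi => x Ux; apply: near_eq_derive; exact: (open_in_near oU fg Ux).
Qed.

Lemma Ck_onS k U f : Ck_on k.+1 U f -> Ck_on k U f.
Proof.
elim: k f => [|k IHk] f [cf df]; split=> // i.
by have [dfi Dfi] := df i; split=> //; exact: IHk.
Qed.

Lemma Ck_on_cst k U (a : R) : open U -> Ck_on k U (cst a).
Proof.
move=> oU; elim: k a => [|k IHk] a; (split; first by
  move=> x _; exact: cst_continuous) => // i; split=> [x _|].
  exact: derivable_cst.
by apply: Ck_on_eq (IHk 0) => // x _; rewrite derive_cst.
Qed.

Lemma Ck_onD k U f g : open U -> Ck_on k U f -> Ck_on k U g ->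
  Ck_on k U (f + g).
Proof.
move=> oU; elim: k f g => [|k IHk] f g [cf df] [cg dg]; (split; first by
  move=> x Ux; apply: continuousD; [exact: cf|exact: cg]) => // i.
have [dfi Dfi] := df i; have [dgi Dgi] := dg i; split=> [x Ux|].
  by apply: derivableD; [exact: dfi|exact: dgi].
apply: Ck_on_eq (IHk _ _ Dfi Dgi) => // x Ux.
by rewrite deriveD; [|exact: dfi|exact: dgi].
Qed.

Lemma Ck_onM k U f g : open U -> Ck_on k U f -> Ck_on k U g ->
  Ck_on k U (f * g).
Proof.
move=> oU; elim: k f g => [|k IHk] f g fk gk; have [cf df] := fk;
  have [cg dg] := gk; (split; first by
  move=> x Ux; apply: continuousM; [exact: cf|exact: cg]) => // i.
have [dfi Dfi] := df i; have [dgi Dgi] := dg i; split=> [x Ux|].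
  by apply: derivableM; [exact: dfi|exact: dgi].
apply: Ck_on_eq (Ck_onD oU (IHk _ _ (Ck_onS fk) Dgi)
                           (IHk _ _ (Ck_onS gk) Dfi)) => // x Ux.
by rewrite deriveM; [|exact: dfi|exact: dgi].
Qed.

End euclidean_smoothness.

(* [cmap] and [cinv] are total functions; only their restrictions to the open
   sets [cdom] and [ccod] are meaningful. *)
Record chart (R : realType) (m : nat) (T : topologicalType) := Chart {
  cdom : set T;
  ccod : set 'rV[R]_m;
  cmap : T -> 'rV[R]_m;
  cinv : 'rV[R]_m -> T;
  cdom_open : open cdom;
  ccod_open : open ccod;
  cmap_cod : cmap @` cdom `<=` ccod;
  cinv_dom : cinv @` ccod `<=` cdom;
  cmapK : {in cdom, cancel cmap cinv};
  cinvK : {in ccod, cancel cinv cmap};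
  cmap_continuous : {in cdom, continuous cmap};
  cinv_continuous : {in ccod, continuous cinv} }.

(* The atlas need not be maximal: any atlas determines the smooth structure. *)
Record manifold (R : realType) (m : nat) := Manifold {
  mpoint :> topologicalType;
  manifold_nonempty : [set: mpoint] !=set0;
  manifold_hausdorff : hausdorff_space mpoint;
  manifold_second_countable : @second_countable mpoint;
  atlas : set (chart R m mpoint);
  atlas_cover : forall p : mpoint, exists2 c, atlas c & cdom c p;
  atlas_compatible : forall c d, atlas c -> atlas d -> forall i : 'I_m,
    Cinfty_on (ccod c `&` cinv c @^-1` cdom d)
      (fun x => cmap d (cinv c x) 0 i) }.

Section manifolds.
Context (R : realType) (m : nat) (M : manifold R m).
Implicit Types p : M.

Definition smooth : {pred M -> R} := fun f =>
  `[< forall c, atlas c -> Cinfty_on (ccod c) (f \o cinv c) >].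

Lemma smooth_cst (a : R) : cst a \in smooth.
Proof. by apply/asboolP => c _ k; exact/Ck_on_cst/ccod_open. Qed.

Lemma smoothD f g : f \in smooth -> g \in smooth -> f + g \in smooth.
Proof.
move=> /asboolP sf /asboolP sg; apply/asboolP => c Mc k.
by apply: (@Ck_onD _ _ _ _ (f \o cinv c) (g \o cinv c));
  [exact: ccod_open|exact: sf|exact: sg].
Qed.

Lemma smoothM f g : f \in smooth -> g \in smooth -> f * g \in smooth.
Proof.
move=> /asboolP sf /asboolP sg; apply/asboolP => c Mc k.
by apply: (@Ck_onM _ _ _ _ (f \o cinv c) (g \o cinv c));
  [exact: ccod_open|exact: sf|exact: sg].
Qed.

Lemma smoothZ (a : R) f : f \in smooth -> a *: f \in smooth.
Proof. by move=> sf; apply: (smoothM (smooth_cst a) sf). Qed.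

Lemma smoothN f : f \in smooth -> - f \in smooth.
Proof. by move=> sf; rewrite -scaleN1r; exact: smoothZ. Qed.

Record Cinf := MkCinf { Cinf_val :> M -> R; CinfP : Cinf_val \in smooth }.
HB.instance Definition _ := [isSub for Cinf_val].
HB.instance Definition _ := [Choice of Cinf by <:].

Fact smooth_subring_closed : subring_closed smooth.
Proof.
split=> [|f g sf sg|f g]; [exact: smooth_cst| |exact: smoothM].
by apply: smoothD => //; exact: smoothN.
Qed.
HB.instance Definition _ := GRing.SubChoice_isSubComPzRing.Build
  (M -> R) smooth Cinf smooth_subring_closed.

Fact smooth_subsemimod_closed : subsemimod_closed smooth.
Proof.
split; last by move=> a f; exact: smoothZ.
by split; [exact: smooth_cst|exact: smoothD].
Qed.
HB.instance Definition _ := GRing.SubZmodule_isSubLmodule.Build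
  R (M -> R) smooth Cinf smooth_subsemimod_closed.

(* The tangent space at p is the space of derivations at p of the algebra of
   smooth functions. *)
Definition derivation_at p : {pred Cinf -> R^o} := fun v =>
  `[< (forall a f g, v (a *: f + g) = a * v f + v g) /\
      (forall f g, v (f * g) = f p * v g + g p * v f) >].

Record tangent p := MkTangent {
  tangent_val :> Cinf -> R^o;
  tangentP : tangent_val \in derivation_at p }.

Section tangent_lmod.
Variable p : M.
HB.instance Definition _ := [isSub for @tangent_val p].
HB.instance Definition _ := [Choice of tangent p by <:].

Fact derivation_at_closed : subsemimod_closed (derivation_at p).
Proof.
have addE (u v : Cinf -> R^o) f : (u + v) f = u f + v f by [].
have scaleE (a : R) (u : Cinf -> R^o) f : (a *: u) f = a * u f by [].
have zeroE f : (0 : Cinf -> R^o) f = 0 by [].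
split; first split.
- by apply/asboolP; split=> *; rewrite !zeroE !mulr0 addr0.
- move=> u v /asboolP[lu du] /asboolP[lv dv]; apply/asboolP; split=> *.
    by rewrite !addE lu lv mulrDr addrACA.
  by rewrite !addE du dv !mulrDr addrACA.
- move=> a u /asboolP[lu du]; apply/asboolP; split=> *.
    by rewrite !scaleE lu mulrDr mulrCA.
  by rewrite !scaleE du mulrDr !(mulrCA a).
Qed.
HB.instance Definition _ := GRing.SubChoice_isSubLmodule.Build
  R (Cinf -> R^o) (derivation_at p) (tangent p) derivation_at_closed.
End tangent_lmod.

(* A field of tangent vectors X is smooth iff p |-> X_p f is smooth for every
   smooth f; likewise the smoothness of tensor fields below is tested on smooth
   vector fields (and functions). *)
Record vfield := MkVfield {
  vf_at :> forall p, tangent p;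
  vf_smooth : forall f : Cinf, (fun p => vf_at p f) \in smooth }.

Definition vapp (X : vfield) (f : Cinf) : Cinf := MkCinf (vf_smooth X f).

Lemma tangent_eqP p (u v : tangent p) : (forall f, u f = v f) -> u = v.
Proof. by move=> uv; apply/val_inj/funext. Qed.

Lemma vfield_eqP (X Y : vfield) : (forall p, X p = Y p) -> X = Y.
Proof.
case: X Y => [X sX] [Y sY] /= XY; have {}XY := functional_extensionality_dep XY.
by subst Y; congr MkVfield; exact: Prop_irrelevance.
Qed.

HB.instance Definition _ := gen_eqMixin vfield.
HB.instance Definition _ := gen_choiceMixin vfield.

Fact vf_zero_smooth (f : Cinf) : (fun p => (0 : tangent p) f) \in smooth.
Proof. exact: (smooth_cst 0). Qed.
Definition vf_zero : vfield := MkVfield vf_zero_smooth.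

Fact vf_add_smooth (X Y : vfield) (f : Cinf) :
  (fun p => (X p + Y p) f) \in smooth.
Proof. exact: smoothD (vf_smooth X f) (vf_smooth Y f). Qed.
Definition vf_add X Y : vfield := MkVfield (vf_add_smooth X Y).

Fact vf_opp_smooth (X : vfield) (f : Cinf) : (fun p => (- X p) f) \in smooth.
Proof. exact: smoothN (vf_smooth X f). Qed.
Definition vf_opp X : vfield := MkVfield (vf_opp_smooth X).

Fact vf_scale_smooth (f : Cinf) (X : vfield) (h : Cinf) :
  (fun p => (f p *: X p) h) \in smooth.
Proof. exact: smoothM (CinfP f) (vf_smooth X h). Qed.
Definition vf_scale f X : vfield := MkVfield (vf_scale_smooth f X).

Fact vf_addA : associative vf_add.
Proof. by move=> X Y Z; apply: vfield_eqP => p; exact: addrA. Qed.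
Fact vf_addC : commutative vf_add.
Proof. by move=> X Y; apply: vfield_eqP => p; exact: addrC. Qed.
Fact vf_add0 : left_id vf_zero vf_add.
Proof. by move=> X; apply: vfield_eqP => p; exact: add0r. Qed.
Fact vf_addN : left_inverse vf_zero vf_opp vf_add.
Proof. by move=> X; apply: vfield_eqP => p; exact: addNr. Qed.
HB.instance Definition _ :=
  GRing.isZmodule.Build vfield vf_addA vf_addC vf_add0 vf_addN.

Fact vf_scaleA (f g : Cinf) (X : vfield) :
  vf_scale f (vf_scale g X) = vf_scale (f * g) X.
Proof. by apply: vfield_eqP => p; exact: scalerA. Qed.
Fact vf_scale1 : left_id 1 vf_scale.
Proof. by move=> X; apply: vfield_eqP => p; exact: scale1r. Qed.
Fact vf_scaleDr : right_distributive vf_scale +%R.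
Proof. by move=> f X Y; apply: vfield_eqP => p; exact: scalerDr. Qed.
Fact vf_scaleDl (X : vfield) : {morph vf_scale^~ X : f g / f + g}.
Proof. by move=> f g; apply: vfield_eqP => p; exact: scalerDl. Qed.
HB.instance Definition _ := GRing.Zmodule_isLmodule.Build Cinf vfield
  vf_scaleA vf_scale1 vf_scaleDr vf_scaleDl.

Lemma tangentL p (v : tangent p) (a : R) (f g : Cinf) :
  v (a *: f + g) = a * v f + v g.
Proof. by have /asboolP[] := tangentP v. Qed.

Lemma tangentM p (v : tangent p) (f g : Cinf) :
  v (f * g) = f p * v g + g p * v f.
Proof. by have /asboolP[] := tangentP v. Qed.

Lemma vappL (X : vfield) (a : R) (f g : Cinf) :
  vapp X (a *: f + g) = a *: vapp X f + vapp X g.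
Proof. by apply/val_inj/funext => p; exact: tangentL. Qed.

Lemma vappM (X : vfield) (f g : Cinf) :
  vapp X (f * g) = f * vapp X g + g * vapp X f.
Proof. by apply/val_inj/funext => p; exact: tangentM. Qed.

Definition bracket_val (X Y : vfield) p : Cinf -> R^o :=
  fun f => X p (vapp Y f) - Y p (vapp X f).

Fact bracket_derivation X Y p : bracket_val X Y p \in derivation_at p.
Proof.
rewrite /bracket_val; apply/asboolP; split=> [a f g|f g].
  by rewrite !vappL !tangentL mulrBr opprD addrACA.
have tangentD (v : tangent p) h k : v (h + k) = v h + v k.
  by rewrite -[h in LHS]scale1r tangentL mul1r.
rewrite !vappM !tangentD !tangentM /=.
ring.
Qed.

Fact bracket_smooth X Y (f : Cinf) :
  (fun p => MkTangent (bracket_derivation X Y p) f) \in smooth.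
Proof. exact: CinfP (vapp X (vapp Y f) - vapp Y (vapp X f)). Qed.

Definition bracket (X Y : vfield) : vfield := MkVfield (bracket_smooth X Y).

Record form1 := MkForm1 {
  form1_at : forall p, {scalar tangent p};
  form1_smooth : forall X : vfield, (fun p => form1_at p (X p)) \in smooth }.

Definition form1_app (a : form1) (X : vfield) : Cinf :=
  MkCinf (form1_smooth a X).

Record endo := MkEndo {
  endo_at : forall p, {linear tangent p -> tangent p};
  endo_smooth : forall (X : vfield) (f : Cinf),
    (fun p => endo_at p (X p) f) \in smooth }.

Definition endo_app (F : endo) (X : vfield) : vfield :=
  MkVfield (endo_smooth F X).

Record metric := MkMetric {
  metric_at : forall p, tangent p -> tangent p -> R;
  metric_linear : forall p (u : tangent p), scalar (metric_at u);
  metric_sym : forall p (u v : tangent p), metric_at u v = metric_at v u;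
  metric_pos : forall p (u : tangent p), u != 0 -> 0 < metric_at u u;
  metric_smooth : forall X Y : vfield,
    (fun p => metric_at (X p) (Y p)) \in smooth }.

Definition metric_app (g : metric) (X Y : vfield) : Cinf :=
  MkCinf (metric_smooth g X Y).

Record connection := MkConnection {
  conn_app :> vfield -> vfield -> vfield;
  connDl : forall (f : Cinf) (X Y Z : vfield),
    conn_app (f *: X + Y) Z = f *: conn_app X Z + conn_app Y Z;
  connDr : forall X Y Z : vfield,
    conn_app X (Y + Z) = conn_app X Y + conn_app X Z;
  connM : forall (f : Cinf) (X Y : vfield),
    conn_app X (f *: Y) = vapp X f *: Y + f *: conn_app X Y }.

End manifolds.

Coercion form1_app : form1 >-> Funclass.
Coercion endo_app : endo >-> Funclass.
Coercion metric_app : metric >-> Funclass.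

Section differential_forms.
Context (R : realType) (m : nat) (M : manifold R m).

(* A differential k-form is represented by its values on k vector fields;
   multilinearity and alternation are not part of the type, but hold for the
   forms built below. *)
Definition kform (k : nat) : Type := ('I_k -> vfield M) -> Cinf M.

(* The factor 1/(k+l)! is the normalization consistent with the 1/2 in
   [ext_d]. *)
Definition wedge k l (a : kform k) (b : kform l) : kform (k + l) := fun X =>
  ((k + l)`!%:R : R)^-1 *: \sum_(s : 'S_(k + l)) (-1) ^+ s *
    (a (fun i => X (s (lshift l i))) * b (fun j => X (s (rshift k j)))).

Fixpoint wedge_pow (a : kform 2) (n : nat) : kform (n * 2) :=
  if n is n'.+1 then wedge a (@wedge_pow a n') else fun=> 1.

Definition ext_d (a : form1 M) (X Y : vfield M) : Cinf M :=
  (2^-1 : R) *: (vapp X (a Y) - vapp Y (a X) - a (bracket X Y)).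

Definition kform_of_form1 (a : form1 M) : kform 1 := fun X => a (X ord0).

Definition kform_ext_d (a : form1 M) : kform 2 :=
  fun X => ext_d a (X ord0) (X ord_max).

End differential_forms.

Arguments wedge_pow {R m M} a n.

Section curvature.
Context (R : realType) (m : nat) (M : manifold R m).
Variables (g : metric M) (D : connection M).
Implicit Types X Y Z W : vfield M.

Definition levi_civita : Prop :=
  (forall X Y, D X Y - D Y X = bracket X Y) /\
  (forall X Y Z, vapp X (g Y Z) = g (D X Y) Z + g Y (D X Z)).

Definition curv X Y Z : vfield M :=
  D X (D Y Z) - D Y (D X Z) - D (bracket X Y) Z.

Definition nabla_curv W X Y Z : vfield M :=
  D W (curv X Y Z) - curv (D W X) Y Z - curv X (D W Y) Z - curv X Y (D W Z).

Definition flat : Prop := forall X Y Z, curv X Y Z = 0.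

Definition constant_curvature : Prop := exists lambda : R, forall X Y Z,
  curv X Y Z = (lambda *: g Y Z) *: X - (lambda *: g X Z) *: Y.

End curvature.

Record contact_metric (R : realType) (n : nat) (M : manifold R (2 * n).+1) :=
  ContactMetric {
  eta : form1 M;
  xi : vfield M;
  phi : endo M;
  gm : metric M;
  eta_contact : forall p : M, exists X : 'I_(1 + n * 2) -> vfield M,
    wedge (kform_of_form1 eta) (wedge_pow (kform_ext_d eta) n) X p != 0;
  eta_xi : eta xi = 1;
  ext_d_eta_xi : forall X, ext_d eta xi X = 0;
  eta_gm : forall X, eta X = gm X xi;
  ext_d_eta_gm : forall X Y, ext_d eta X Y = gm X (phi Y);
  phi_phi : forall X, phi (phi X) = - X + eta X *: xi }.

Definition phi_recurrent (R : realType) (n : nat) (M : manifold R (2 * n).+1)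
    (C : contact_metric M) (D : connection M) : Prop :=
  exists A : form1 M, (exists W, A W != 0) /\
    forall X Y Z W : vfield M,
      phi C (phi C (nabla_curv D W X Y Z)) = A W *: curv D X Y Z.

(* Main.v *)
From mathcomp Require Import all_boot all_order all_algebra all_fingroup.
From mathcomp Require Import boolp reals topology.
From mathcomp Require Import ring lra.
Require Import Defs.

(* For B X := nabla_X xi one has g(B X, Y) - g(X, B Y) = 2 d eta(X, Y), so the
   metric adjoint of B is B + 2 phi.  When M is flat, R(X, Y) xi = 0 says that
   (nabla_X B) Y is symmetric.  The case X = xi, with phi^2 = -1 + eta xi,
   yields B^2 = 0 and B^* B + B B^* = 4 (1 - eta xi).  On im B^* the form
   g((nabla_X B) Y, Z) is then symmetric in X, Y and skew in Y, Z, hence zero,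
   which propagates to (nabla_X B) Y = - g(B X, B Y) xi.  Differentiating
   once more, R(U, X) (B Y) = 0 becomes g(B X, B Y) B U = g(B U, B Y) B X: the
   rank of B is at most one, d eta /\ d eta = 0, and so n = 1.

   Flatness itself comes from phi-recurrence: constant curvature makes R
   parallel, so R = 0 at a point where A does not vanish, and a nonzero lambda
   would make d eta vanish at that point. *)

Set Implicit Arguments.
Unset Strict Implicit.
Unset Printing Implicit Defensive.

Import Order.TTheory GRing.Theory Num.Theory.
Local Open Scope ring_scope.

(** * Smooth functions and their derivatives along vector fields *)

Section smooth_functions.
Context (R : realType) (m : nat) (M : manifold R m).
Implicit Types (f h : Cinf M) (X Y Z : vfield M).

Lemma Cinf_eq f h : (forall p, f p = h p) -> f = h.
Proof. by move=> fh; apply/val_inj/funext. Qed.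

Lemma Cinf_addE f h p : (f + h) p = f p + h p. Proof. by []. Qed.
Lemma Cinf_oppE f p : (- f) p = - f p. Proof. by []. Qed.
Lemma Cinf_mulE f h p : (f * h) p = f p * h p. Proof. by []. Qed.
Lemma Cinf_scaleE (a : R) f p : (a *: f) p = a * f p. Proof. by []. Qed.
Lemma Cinf_zeroE p : (0 : Cinf M) p = 0. Proof. by []. Qed.
Lemma Cinf_oneE p : (1 : Cinf M) p = 1. Proof. by []. Qed.

Lemma Cinf_mulrnE f k p : (f *+ k) p = f p *+ k.
Proof.
elim: k => [|k IHk]; first by rewrite !mulr0n.
by rewrite !mulrS Cinf_addE IHk.
Qed.

Definition CinfE := (Cinf_addE, Cinf_oppE, Cinf_mulE, Cinf_scaleE, Cinf_zeroE,
  Cinf_oneE, Cinf_mulrnE).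

Lemma vapp1 X : vapp X 1 = 0.
Proof.
have := vappM X 1 1; rewrite !mulr1 mul1r => X1.
by apply: (addrI (vapp X 1)); rewrite addr0 -X1.
Qed.

Lemma vappD X f h : vapp X (f + h) = vapp X f + vapp X h.
Proof. by have := vappL X 1 f h; rewrite !scale1r. Qed.

Lemma vapp0 X : vapp X 0 = 0.
Proof. by apply: (addrI (vapp X 0)); rewrite -vappD !addr0. Qed.

Lemma vappZ X (a : R) f : vapp X (a *: f) = a *: vapp X f.
Proof. by have := vappL X a f 0; rewrite vapp0 !addr0. Qed.

Lemma vappN X f : vapp X (- f) = - vapp X f.
Proof. by rewrite -scaleN1r vappZ scaleN1r. Qed.

End smooth_functions.

(** At a point, the goal and the equations in the context become linear in the monomials that occur,
    within reach of [lra]. *)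
Ltac pointwise :=
  apply: Cinf_eq => p;
  repeat match goal with H : _ = _ |- _ =>
    move/(congr1 (fun f : Cinf _ => f p)): H end;
  rewrite ?CinfE; intros; lra.

(** * Calculus of a metric and a connection on vector fields *)

Section connections.
Context (R : realType) (m : nat) (M : manifold R m).
Context (g : metric M) (D : connection M).
Implicit Types (f : Cinf M) (X Y Z W : vfield M).

Lemma metricC X Y : g X Y = g Y X.
Proof. by apply: Cinf_eq => p; exact: metric_sym. Qed.

Lemma metricDr X Y Z : g X (Y + Z) = g X Y + g X Z.
Proof.
apply: Cinf_eq => p.
by have := metric_linear g (X p) 1 (Y p) (Z p); rewrite scale1r mul1r.
Qed.

Lemma metricZr f X Y : g X (f *: Y) = f * g X Y.
Proof.
apply: Cinf_eq => p; have gX0 : metric_at g (X p) 0 = 0.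
  have := metric_linear g (X p) (-1) 0 0.
  by rewrite scaleN1r oppr0 addr0 mulN1r addNr.
by have := metric_linear g (X p) (f p) (Y p) 0; rewrite gX0 !addr0.
Qed.

Lemma metricNr X Y : g X (- Y) = - g X Y.
Proof. by rewrite -scaleN1r metricZr mulN1r. Qed.

Lemma metricDl X Y Z : g (X + Y) Z = g X Z + g Y Z.
Proof. by rewrite metricC metricDr !(metricC Z). Qed.

Lemma metricZl f X Y : g (f *: X) Y = f * g X Y.
Proof. by rewrite metricC metricZr metricC. Qed.

Lemma metricNl X Y : g (- X) Y = - g X Y.
Proof. by rewrite metricC metricNr metricC. Qed.

Lemma metric0r X : g X 0 = 0.
Proof. by rewrite -[0 : vfield M](scale0r 0) metricZr mul0r. Qed.

Lemma metric0l X : g 0 X = 0.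
Proof. by rewrite metricC metric0r. Qed.

Definition metricE := (metricDl, metricDr, metricNl, metricNr, metricZl,
  metricZr, metric0l, metric0r).

Lemma metric_at_eq0 X p : g X X p = 0 -> X p = 0.
Proof.
move=> gXX; apply/eqP; apply: contraT => /(metric_pos g).
by have -> : metric_at g (X p) (X p) = 0 by []; rewrite ltxx.
Qed.

Lemma metric_ext X Y : (forall Z, g X Z = g Y Z) -> X = Y.
Proof.
move=> XY; apply/eqP; rewrite -subr_eq0; apply/eqP/vfield_eqP => p.
by apply: metric_at_eq0; rewrite metricDl metricNl XY subrr.
Qed.

Lemma conn_addl X Y Z : D (X + Y) Z = D X Z + D Y Z.
Proof. by have := connDl D 1 X Y Z; rewrite !scale1r. Qed.

Lemma conn0l Z : D 0 Z = 0.
Proof. by apply: (addrI (D 0 Z)); rewrite -conn_addl !addr0. Qed.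

Lemma conn_scalel f X Z : D (f *: X) Z = f *: D X Z.
Proof. by have := connDl D f X 0 Z; rewrite conn0l !addr0. Qed.

Lemma connNl X Z : D (- X) Z = - D X Z.
Proof. by rewrite -[in LHS]scaleN1r conn_scalel scaleN1r. Qed.

Lemma conn0r X : D X 0 = 0.
Proof. by apply: (addrI (D X 0)); rewrite -connDr !addr0. Qed.

Lemma connNr X Y : D X (- Y) = - D X Y.
Proof. by apply: (addrI (D X Y)); rewrite -connDr !subrr conn0r. Qed.

Definition connE := (conn_addl, conn_scalel, connNl, conn0l, connDr, connNr,
  connM, conn0r).

Section levi_civita.
Hypothesis LC : levi_civita g D.

Lemma bracketE X Y : bracket X Y = D X Y - D Y X.
Proof. by have [->] := LC. Qed.

Lemma vapp_metric X Y Z : vapp X (g Y Z) = g (D X Y) Z + g Y (D X Z).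
Proof. by have [_ ->] := LC. Qed.

(** The curvature is built from [g] and a constant; since [g] is parallel, all Leibniz terms
    cancel. *)
Lemma nabla_curv_constant_curvature W X Y Z :
  constant_curvature g D -> nabla_curv D W X Y Z = 0.
Proof.
move=> [l Rl]; rewrite /nabla_curv !Rl; apply: metric_ext => V.
rewrite !(connE, metricE, vappZ, vapp_metric).
pointwise.
Qed.

End levi_civita.
End connections.

(** * Alternating sums over permutations *)

Section alternating_sums.
Context (R : realType) (N : nat).

(** Composition with the transposition pairs permutations of opposite sign and equal [F], so the sum
    is its own negative. *)
Lemma alternating_sum_eq0 (i j : 'I_N) (F : 'S_N -> R) :
  i != j -> (forall s, F (tperm i j * s)%g = F s) ->
  \sum_(s : 'S_N) (-1) ^+ s * F s = 0.
Proof.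
move=> ij FE; set S := (X in X = _); have : S = - S.
  rewrite {1}/S (reindex_inj (mulgI (tperm i j))) -sumrN /=.
  apply: eq_bigr => s _; rewrite FE odd_permM odd_tperm ij addTb signrN.
  by rewrite mulNr.
by move=> ?; lra.
Qed.

Context (T : Type) (b : T -> T -> R) (x : 'I_N -> T).
Hypothesis b_rank1 : forall u v u' v', b u v * b u' v' = b u' v * b u v'.

(** [b_rank1] exchanges the first arguments of the two factors, which is the effect of transposing
    [i] and [k]. *)
Lemma alternating_sum_rank1 (i j k l : 'I_N) : uniq [:: i; j; k; l] ->
  \sum_(s : 'S_N) (-1) ^+ s *
    (b (x (s i)) (x (s j)) * b (x (s k)) (x (s l))) = 0.
Proof.
rewrite /= !inE !negb_or -!andbA => /and5P[ij ik il jk /and3P[jl kl _]].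
apply: (alternating_sum_eq0 ik) => s; rewrite !permM tpermL tpermR.
by rewrite (tpermD ij) 1?eq_sym // (tpermD il kl) b_rank1.
Qed.

Lemma alternating_sum_skew_rank1 (i j k l : 'I_N) : uniq [:: i; j; k; l] ->
  \sum_(s : 'S_N) (-1) ^+ s *
    ((b (x (s i)) (x (s j)) - b (x (s j)) (x (s i))) *
     (b (x (s k)) (x (s l)) - b (x (s l)) (x (s k)))) = 0.
Proof.
move=> ijkl.
pose S i j k l := \sum_(s : 'S_N) (-1) ^+ s *
  (b (x (s i)) (x (s j)) * b (x (s k)) (x (s l))).
transitivity (S i j k l - S i j l k - (S j i k l - S j i l k)).
  rewrite /S -!sumrB; apply: eq_bigr => s _.
  by move: ((-1) ^+ s) => e; ring.
rewrite /S !alternating_sum_rank1 ?subrr //; move: ijkl;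
  rewrite /= !inE !negb_or -!andbA => /and5P[ij ik il jk /and3P[jl kl _]];
  by rewrite 1?[j == i]eq_sym 1?[l == k]eq_sym ij ik il jk jl kl.
Qed.

End alternating_sums.

Lemma uniq_lrshift k l (i j : 'I_k) (i' j' : 'I_l) : i != j -> i' != j' ->
  uniq [:: lshift l i; lshift l j; rshift k i'; rshift k j'].
Proof.
move=> ij ij'.
by rewrite /= !inE eq_lshift eq_rshift !eq_lrshift !negb_or ij ij'.
Qed.

(** * Wedge products at a point *)

Section wedge_at_a_point.
Context (R : realType) (m : nat) (M : manifold R m) (p : M).

Lemma wedge_at k l (a : kform M k) (b : kform M l) X :
  wedge a b X p = ((k + l)`!%:R)^-1 * \sum_(s : 'S_(k + l)) (-1) ^+ s *
    (a (fun i => X (s (lshift l i))) p * b (fun j => X (s (rshift k j))) p).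
Proof.
rewrite /wedge Cinf_scaleE; congr (_ * _).
rewrite (big_morph (fun f : Cinf M => f p) (id1 := 0) (op1 := +%R)) //.
by apply: eq_bigr => s _; case: (odd_perm s); rewrite ?expr1 ?expr0 // CinfE.
Qed.

Lemma wedge_eq0l k l (a : kform M k) (b : kform M l) X :
  (forall Y, a Y p = 0) -> wedge a b X p = 0.
Proof.
by move=> a0; rewrite wedge_at big1 ?mulr0 // => s _; rewrite a0 mul0r mulr0.
Qed.

Lemma wedge_eq0r k l (a : kform M k) (b : kform M l) X :
  (forall Y, b Y p = 0) -> wedge a b X p = 0.
Proof.
by move=> b0; rewrite wedge_at big1 ?mulr0 // => s _; rewrite b0 !mulr0.
Qed.

(** Each power is the right factor of the next one, so vanishing propagates upwards from [k]. *)
Lemma wedge_pow_eq0 (a : kform M 2) n k X :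
  (forall Y, wedge_pow a k Y p = 0) -> (k <= n)%N -> wedge_pow a n X p = 0.
Proof.
move=> ak; elim: n X => [|n IHn] X; first by case: k ak.
rewrite leq_eqVlt => /predU1P[kn|kn]; first by case: _ / kn X.
by apply: wedge_eq0r => Y; exact: IHn.
Qed.

Lemma wedge_pow2_eq0 (a : kform M 2) (b : vfield M -> vfield M -> R) X :
  (forall Y, a Y p =
    2^-1 * (b (Y ord0) (Y ord_max) - b (Y ord_max) (Y ord0))) ->
  (forall U V U' V', b U V * b U' V' = b U' V * b U V') ->
  wedge_pow a 2 X p = 0.
Proof.
move=> aE b1; have pow1 Y : wedge_pow a 1 Y p = ((2 + 0 * 2)`!%:R)^-1 *
    \sum_(s : 'S_(2 + 0 * 2)) (-1) ^+ s *
      (a (fun i => Y (s (lshift (0 * 2) i))) p * 1) by exact: wedge_at.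
rewrite wedge_at.
under eq_bigr do rewrite pow1 !mulr_sumr.
set f := ((2 + 0 * 2)`!%:R)^-1.
(* For each fixed permutation [t] of the inner wedge, the sum over the outer permutations already
   vanishes; [k] and [l] are the last two positions in the order given by [t]. *)
rewrite exchange_big big1 ?mulr0 //= => t _.
pose w u v := b u v - b v u.
pose c := f * ((-1) ^+ t * (2^-1 * 2^-1)).
pose k := rshift 2 (t (lshift (0 * 2) ord0)).
pose l := rshift 2 (t (lshift (0 * 2) ord_max)).
transitivity (c * \sum_(s : 'S_(2 + 1 * 2)) (-1) ^+ s *
    (w (X (s (lshift _ ord0))) (X (s (lshift _ ord_max))) *
     w (X (s k)) (X (s l)))).
  rewrite mulr_sumr; apply: eq_bigr => s _.
  rewrite !aE -!/(w _ _) /c {c} -/k -/l.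
  move: (w _ _) (w _ _) ((-1) ^+ s) ((-1) ^+ t) f (2^-1).
  by move=> w1 w2 e1 e2 ? h; ring.
have ijkl : uniq [:: lshift (1 * 2) ord0; lshift (1 * 2) ord_max; k; l].
  by apply: uniq_lrshift => //; rewrite (inj_eq perm_inj).
by rewrite [X in c * X](alternating_sum_skew_rank1 X b1 ijkl) mulr0.
Qed.

End wedge_at_a_point.

(* Pairing the goal and the context with one arbitrary field reduces equations of vector fields to
   scalar ones. *)
Tactic Notation "metricwise" constr(g) :=
  apply: (metric_ext (g := g)) => ?;
  match goal with |- metric_app _ _ ?V = _ =>
    repeat match goal with H : _ = _ |- _ =>
      move/(congr1 (fun X => metric_app g X V)): H end;
    rewrite ?metricE; intros; pointwise
  end.

(** * Contact metric structures and the operator B *)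

Section contact_metric_structure.
Context (R : realType) (n : nat) (M : manifold R (2 * n).+1).
Context (C : contact_metric M) (D : connection M).
Hypothesis LC : levi_civita (gm C) D.
Implicit Types (f : Cinf M) (X Y Z U V W : vfield M).

Local Notation g := (gm C).
Local Notation phi := (phi C).
Local Notation xi := (xi C).

Lemma phiD X Y : phi (X + Y) = phi X + phi Y.
Proof. by apply: vfield_eqP => p; exact: linearD. Qed.

Lemma phiZ f X : phi (f *: X) = f *: phi X.
Proof. by apply: vfield_eqP => p; exact: linearZ. Qed.

Lemma phiN X : phi (- X) = - phi X.
Proof. by rewrite -scaleN1r phiZ scaleN1r. Qed.

Lemma phi0 : phi 0 = 0.
Proof. by rewrite -[0](scale0r xi) phiZ !scale0r. Qed.

Lemma metric_xi : g xi xi = 1.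
Proof. by rewrite -eta_gm eta_xi. Qed.

Definition dxi X := D X xi.

Lemma dxiD X Y : dxi (X + Y) = dxi X + dxi Y.
Proof. exact: conn_addl. Qed.

Lemma dxiZ f X : dxi (f *: X) = f *: dxi X.
Proof. exact: conn_scalel. Qed.

Lemma dxiN X : dxi (- X) = - dxi X.
Proof. exact: connNl. Qed.

Lemma metric_dxi_xi X : g (dxi X) xi = 0.
Proof.
have := vapp_metric LC X xi xi; rewrite metric_xi vapp1 (metricC _ xi) => ?.
by pointwise.
Qed.

(** Torsion-freeness removes the bracket from d eta, and only derivatives of xi survive; the 2
    clears the 1/2 in [ext_d]. *)
Lemma metric_phi X Y : g X (phi Y) *+ 2 = g (dxi X) Y - g X (dxi Y).
Proof.
rewrite -ext_d_eta_gm /ext_d !eta_gm !(vapp_metric LC) (bracketE LC).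
rewrite !metricE (metricC _ Y) /dxi; pointwise.
Qed.

Lemma metric_phiC X Y : g (phi X) Y = - g X (phi Y).
Proof.
have := metric_phi X Y; have := metric_phi Y X.
rewrite !(metricC _ Y) (metricC _ (dxi Y)) => ? ?.
by pointwise.
Qed.

(** Since d eta(xi, X) = 0 and B X is orthogonal to xi, [metric_phi] leaves only g(B xi, X) = 0: the
    integral curves of xi are geodesics. *)
Lemma dxi_xi : dxi xi = 0.
Proof.
apply: (metric_ext (g := g)) => X.
have := metric_phi xi X; rewrite -ext_d_eta_gm ext_d_eta_xi.
rewrite (metricC _ xi (dxi X)) metric_dxi_xi metric0l => ?.
by pointwise.
Qed.

Lemma phi_xi : phi xi = 0.
Proof.
apply: (metric_ext (g := g)) => X.
have := metric_phi X xi; rewrite dxi_xi metric_dxi_xi (metricC _ X).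
by rewrite !metricE => ?; pointwise.
Qed.

Lemma phi2 X : phi (phi X) = - X + g X xi *: xi.
Proof. by rewrite phi_phi eta_gm. Qed.

Lemma dxi0 : dxi 0 = 0.
Proof. exact: conn0l. Qed.

(** The metric adjoint B^* of B, by [metric_phi]. *)
Definition dxi_adj X := dxi X + (phi X + phi X).

Lemma dxi_adjP X Y : g (dxi X) Y = g X (dxi_adj Y).
Proof.
have := metric_phi X Y; rewrite /dxi_adj !metricE => ?.
by pointwise.
Qed.

(** * The flat case: algebraic relations between B, B^* and phi *)

Section flat.
Hypothesis flatD : flat D.

Definition nabla_dxi X Y := D X (dxi Y) - dxi (D X Y).

Lemma nabla_dxiC X Y : nabla_dxi X Y = nabla_dxi Y X.
Proof.
apply: (metric_ext (g := g)) => Z; have := congr1 (g^~ Z) (flatD X Y xi).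
rewrite /curv (bracketE LC) /nabla_dxi /dxi !(connE, metricE) => ?.
by pointwise.
Qed.

(** Symmetry of (nabla_X B) Y at xi, with B xi = 0, says that nabla_xi B = - B^2. *)
Lemma conn_xi_dxi X : D xi (dxi X) = dxi (D xi X) - dxi (dxi X).
Proof.
have := nabla_dxiC xi X; rewrite /nabla_dxi dxi_xi conn0r => H.
by rewrite -(subrK (dxi (D xi X)) (D xi _)) H sub0r addrC.
Qed.

Lemma metric_nabla_xi_phi X Y : g X (D xi (phi Y) - phi (D xi Y)) *+ 2 =
  g X (dxi (dxi Y)) - g (dxi (dxi X)) Y.
Proof.
have /(congr1 (vapp xi)) := metric_phi X Y.
have := metric_phi (D xi X) Y; have := metric_phi X (D xi Y).
rewrite !mulr2n !(vappD, vappN) !(vapp_metric LC) !conn_xi_dxi.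
by rewrite !metricE => ? ? ?; pointwise.
Qed.

Lemma dxi_phi2 X : dxi (phi (phi X)) = - dxi X.
Proof. by rewrite phi2 dxiD dxiN dxiZ dxi_xi scaler0 addr0. Qed.

Lemma phi2_dxi X : phi (phi (dxi X)) = - dxi X.
Proof. by rewrite phi2 metric_dxi_xi scale0r addr0. Qed.

Lemma phi3 X : phi (phi (phi X)) = - phi X.
Proof. by rewrite phi2 metric_phiC phi_xi metric0r oppr0 scale0r addr0. Qed.

Definition anticomm X :=
  dxi (phi X) + phi (dxi X) + (phi (phi X) + phi (phi X)).

Lemma nabla_xi_phiE X : D xi (phi X) - phi (D xi X) = - anticomm X.
Proof.
apply: (metric_ext (g := g)) => Y; rewrite !(metricC _ _ Y).
have := metric_nabla_xi_phi Y X; rewrite !dxi_adjP /dxi_adj /anticomm.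
by rewrite !(dxiD, phiD, metricE) => ?; pointwise.
Qed.

(** As nabla_xi xi = 0, phi^2 = -1 + eta xi is parallel along xi, so nabla_xi phi anticommutes with
    phi. Expanded, this reads phi B phi = B + 2 phi; one more phi gives the claim. *)
Lemma dxi_phi X : dxi (phi X) = - phi (dxi X) - (phi (phi X) + phi (phi X)).
Proof.
have conn_xi_phi Y : D xi (phi Y) = phi (D xi Y) - anticomm Y.
  by rewrite -nabla_xi_phiE addrC subrK.
have phi_anticomm Y : anticomm (phi Y) + phi (anticomm Y) = 0.
  have := congr1 (D xi) (phi2 Y); rewrite !conn_xi_phi phiD phiN phi2.
  rewrite !connE (vapp_metric LC) -/(dxi xi) dxi_xi metric0r addr0 scaler0.
  rewrite addr0.
  by move=> ?; metricwise g.
have phi_dxi_phi Y : phi (dxi (phi Y)) = dxi Y + (phi Y + phi Y).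
  have := phi_anticomm Y; rewrite /anticomm !phiD phi2_dxi dxi_phi2 !phi3.
  by move=> ?; metricwise g.
have := congr1 phi (phi_dxi_phi X); rewrite !phiD phi2_dxi => ?.
by metricwise g.
Qed.

Lemma conn_xi_phi X : D xi (phi X) = phi (D xi X).
Proof.
have := nabla_xi_phiE X; rewrite /anticomm dxi_phi => ?.
by metricwise g.
Qed.

(** Differentiating [dxi_phi] along xi makes B^2 anticommute with phi, while using [dxi_phi] twice
    makes them commute. So phi B^2 = 0, and phi^2 = -1 on im B. *)
Lemma dxi2 X : dxi (dxi X) = 0.
Proof.
have phi_dxi2 Y : phi (dxi (dxi Y)) = 0.
  have := congr1 (D xi) (dxi_phi Y).
  rewrite !(connE, conn_xi_phi, conn_xi_dxi) !dxi_phi !(dxiD, dxiN) !dxi_phi2.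
  rewrite !dxi_phi !(phiD, phiN) !phi2_dxi.
  by move=> ?; metricwise g.
have := congr1 phi (phi_dxi2 X); rewrite phi2_dxi phi0 => ?.
by metricwise g.
Qed.

Lemma dxi_adj2 X : dxi_adj (dxi_adj X) = 0.
Proof.
apply: (metric_ext (g := g)) => Y; rewrite metricC -!dxi_adjP dxi2.
by rewrite !metricE.
Qed.

Lemma metric_dxi_adj_xi X : g (dxi_adj X) xi = 0.
Proof. by rewrite metricC -dxi_adjP dxi_xi metric0l. Qed.

(** With B^2 = 0 the left side is 2 (phi B + B phi) = -4 phi^2. It splits every field into parts in
    im B^*, im B and along xi. *)
Lemma dxi_adj_split X :
  dxi_adj (dxi X) + dxi (dxi_adj X) = 4%:R *: (X - g X xi *: xi).
Proof.
have := phi2 X; rewrite /dxi_adj !(dxiD, dxi2, dxi_phi).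
rewrite !scaler_nat !mulrS mulr0n => ?.
by metricwise g.
Qed.

(** * The covariant derivative of B *)

Lemma nabla_dxiD X Y Z :
  nabla_dxi X (Y + Z) = nabla_dxi X Y + nabla_dxi X Z.
Proof. by rewrite /nabla_dxi dxiD !connDr dxiD; metricwise g. Qed.

Lemma nabla_dxiZ f X Y : nabla_dxi X (f *: Y) = f *: nabla_dxi X Y.
Proof. by rewrite !(nabla_dxiC X) /nabla_dxi !conn_scalel dxiZ -scalerBr. Qed.

Lemma nabla_dxi_xi X : nabla_dxi X xi = 0.
Proof. by rewrite /nabla_dxi dxi_xi conn0r -/(dxi X) dxi2 subr0. Qed.

(** The derivative of B^2 = 0. *)
Lemma nabla_dxi_dxi X Y : nabla_dxi X (dxi Y) = - dxi (nabla_dxi X Y).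
Proof.
by rewrite /nabla_dxi dxi2 conn0r dxiD dxiN dxi2 subr0 sub0r.
Qed.

Lemma metric_nabla_dxi_xi X Y :
  g (nabla_dxi X Y) xi = - g (dxi X) (dxi Y).
Proof.
have := congr1 (vapp X) (metric_dxi_xi Y); rewrite (vapp_metric LC).
rewrite vapp0 -/(dxi X) => ?.
rewrite /nabla_dxi !metricE metric_dxi_xi (metricC _ (dxi X)).
by pointwise.
Qed.

(** Hence g(B Y, B Z) = 4 g(Y, Z) on im B^*: there B is twice an isometry. *)
Lemma dxi_adj_dxi_adj X : dxi_adj (dxi (dxi_adj X)) = 4%:R *: dxi_adj X.
Proof.
have := dxi_adj_split (dxi_adj X); rewrite dxi_adj2 metric_dxi_adj_xi.
by rewrite dxi0 addr0 scale0r subr0.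
Qed.

(** The derivative of g(B Y, B Z) = 4 g(Y, Z) on im B^*; the terms with D X Y and D X Z cancel. *)
Lemma metric_nabla_dxi_dxi X U V :
  g (nabla_dxi X (dxi_adj U)) (dxi (dxi_adj V)) =
  - g (nabla_dxi X (dxi_adj V)) (dxi (dxi_adj U)).
Proof.
set Y := dxi_adj U; set Z := dxi_adj V.
have : vapp X (g (dxi Y) (dxi Z)) = 4%:R *: vapp X (g Y Z).
  by rewrite dxi_adjP dxi_adj_dxi_adj metricZr -vappZ; congr vapp; pointwise.
rewrite !(vapp_metric LC) (metricC g (dxi Y)).
have dxiE T : D X (dxi T) = nabla_dxi X T + dxi (D X T) by rewrite subrK.
rewrite !dxiE !(metricDl g (nabla_dxi _ _)) !(dxi_adjP (D X _)).
rewrite !dxi_adj_dxi_adj !metricZr (metricC _ Y) => ?.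
by pointwise.
Qed.

Lemma dxi_dxi_adj_dxi X : dxi (dxi_adj (dxi X)) = 4%:R *: dxi X.
Proof.
have := dxi_adj_split (dxi X); rewrite dxi2 metric_dxi_xi scale0r subr0.
by rewrite {1}/dxi_adj dxi0 phi0 !add0r.
Qed.

Lemma nabla_dxi_rangeE U V : nabla_dxi (dxi_adj U) (dxi_adj V) =
  - g (dxi (dxi_adj U)) (dxi (dxi_adj V)) *: xi.
Proof.
have eq0 (t : vfield M -> vfield M -> vfield M -> Cinf M) X Y Z :
    (forall X Y Z, t X Y Z = t Y X Z) -> (forall X Y Z, t X Y Z = - t X Z Y) ->
    t X Y Z = 0.
  move=> tC tN; have : t X Y Z = - t X Y Z.
    by rewrite {1}tC tN tC tN opprK tC tN.
  by move=> ?; pointwise.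
have tangential W : g (nabla_dxi (dxi_adj U) (dxi_adj V)) (dxi_adj W) = 0.
  apply: (eq0 (fun U V W => g (nabla_dxi (dxi_adj U) (dxi_adj V)) (dxi_adj W))).
    by move=> X Y Z; rewrite nabla_dxiC.
  (* A direction in im B brings out a factor B by [nabla_dxi_dxi]; against B Z it becomes B^* B = 4,
     so skewness passes from im B to im B^*. *)
  move=> X Y Z; have := metric_nabla_dxi_dxi (dxi (dxi_adj X)) Y Z.
  rewrite !(nabla_dxiC (dxi _)) !nabla_dxi_dxi !metricNl !dxi_adjP.
  rewrite !dxi_adj_dxi_adj !metricZr !(nabla_dxiC _ (dxi_adj X)) => ?.
  by pointwise.
have normal W : g (nabla_dxi (dxi_adj U) (dxi_adj V)) (dxi (dxi_adj W)) = 0.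
  apply: (eq0 (fun U V W =>
    g (nabla_dxi (dxi_adj U) (dxi_adj V)) (dxi (dxi_adj W)))).
    by move=> X Y Z; rewrite nabla_dxiC.
  by move=> X Y Z; exact: metric_nabla_dxi_dxi.
(* By [dxi_adj_split], [Z] has parts in im B^* and im B, where the pairing vanishes, and a part
   along xi. *)
apply: (metric_ext (g := g)) => Z.
have := metric_nabla_dxi_xi (dxi_adj U) (dxi_adj V).
move: (nabla_dxi _ _) normal tangential => T normal tangential Txi.
have := congr1 (g T) (dxi_adj_split Z).
rewrite !(metricE, normal, tangential) Txi (metricC _ xi) => ?.
by pointwise.
Qed.

(** In the splitting of [Y], the hypothesis covers im B^*; on im B and along xi both sides vanish,
    as B^2 = 0 and B xi = 0. *)
Lemma nabla_dxi_extend X :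
  (forall V, nabla_dxi X (dxi_adj V) = - g (dxi X) (dxi (dxi_adj V)) *: xi) ->
  forall Y, nabla_dxi X Y = - g (dxi X) (dxi Y) *: xi.
Proof.
move=> HX Y; have := congr1 (nabla_dxi X) (dxi_adj_split Y).
rewrite nabla_dxiD nabla_dxi_dxi !HX dxi_dxi_adj_dxi dxiZ dxi_xi scaler0.
rewrite nabla_dxiZ nabla_dxiD -scaleNr nabla_dxiZ nabla_dxi_xi scaler0 addr0.
by move=> ?; metricwise g.
Qed.

Lemma nabla_dxiE X Y : nabla_dxi X Y = - g (dxi X) (dxi Y) *: xi.
Proof.
(* Symmetry allows extending one argument at a time. *)
apply: nabla_dxi_extend => V; rewrite nabla_dxiC (metricC _ (dxi X)).
by apply: nabla_dxi_extend => U; exact: nabla_dxi_rangeE.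
Qed.

(** * The rank of B and the bound on the dimension *)

Lemma dxi_proportional X Y U :
  g (dxi X) (dxi Y) *: dxi U = g (dxi U) (dxi Y) *: dxi X.
Proof.
have conn_dxi V W : D V (dxi W) = dxi (D V W) - g (dxi V) (dxi W) *: xi.
  by have := nabla_dxiE V W; rewrite /nabla_dxi => ?; metricwise g.
(* Subtracting B (R(U, X) Y) from R(U, X) (B Y) cancels the second derivatives; the xi components
   cancel too. *)
have := flatD U X (dxi Y); have := congr1 dxi (flatD U X Y).
rewrite /curv (bracketE LC) dxi0 !(connE, conn_dxi, vapp_metric LC).
rewrite -!/(dxi _) !(dxiD, dxiN, metricE, metric_dxi_xi) !(metricC g xi).
rewrite !metric_dxi_xi => ? ?.
by metricwise g.
Qed.

Lemma metric_dxi_rank1 p X Y Z W :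
  g (dxi X) Z p * g (dxi Y) W p = g (dxi Y) Z p * g (dxi X) W p.
Proof.
have [/(metric_at_eq0) X0|X0] := eqVneq (g (dxi X) (dxi X) p) 0.
  have gX0 V : g (dxi X) V p = 0.
    transitivity (g 0 V p); last by rewrite metric0l.
    by rewrite /= X0.
  by rewrite !gX0 mul0r mulr0.
(* Where B X is non-zero, g(B X, B X) B Y = g(B Y, B X) B X makes B Y a multiple of it. *)
apply: (mulfI X0).
have E V := congr1 (fun U => g U V p) (dxi_proportional X X Y).
have := E Z; have := E W; rewrite !metricZl !CinfE => EW EZ.
by rewrite mulrCA EW [RHS]mulrA EZ; ring.
Qed.

Lemma flat_dim_le : (n <= 1)%N.
Proof.
rewrite leqNgt; apply/negP => n_ge2; have [p _] := manifold_nonempty M.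
have [X /eqP[]] := eta_contact C p; apply: wedge_eq0r => Y.
apply: (wedge_pow_eq0 (k := 2)) => // Z.
(* By [metric_phi], d eta is half the antisymmetrization of g(B U, V). *)
apply: (@wedge_pow2_eq0 _ _ _ _ _ (fun U V => g (dxi U) V p)) => [U|*].
  have := metric_phi (U ord0) (U ord_max).
  rewrite /kform_ext_d ext_d_eta_gm (metricC g (U ord0) (dxi _)).
  by move/(congr1 (fun f : Cinf M => f p)); rewrite !CinfE => ?; lra.
exact: metric_dxi_rank1.
Qed.

End flat.

(** * From phi-recurrence to flatness *)

Lemma recurrent_constant_curvature_flat :
  (1 <= n)%N -> phi_recurrent C D -> constant_curvature g D -> flat D.
Proof.
move=> n_gt0 [A [[W AW0] recA] cc]; have [l Rl] := cc.
have [p Ap0] : exists p, A W p != 0.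
  apply: contrapT => /forallNP A0; move/eqP: AW0; apply; apply: Cinf_eq => p.
  by apply/eqP/negPn/negP; exact: A0.
suff l0 : l = 0 by move=> X Y Z; rewrite Rl l0 !scale0r subr0.
apply/eqP; apply: contraT => l0; have [X /eqP[]] := eta_contact C p.
apply: wedge_eq0r => Y; apply: (wedge_pow_eq0 (k := 1)) => // Z.
apply: wedge_eq0l => U; rewrite /kform_ext_d ext_d_eta_gm.
(* R(U, xi) xi = lambda (U - eta(U) xi), whose pairing with phi V is lambda d eta(U, V), because im
   phi is orthogonal to xi. *)
have := recA (U ord0) xi xi W.
rewrite (nabla_curv_constant_curvature LC) // !phi0 Rl metric_xi.
move/(congr1 (fun V => g V (phi (U ord_max)) p)).
have xi_phi V : g xi (phi V) = 0.
  by rewrite -[LHS]opprK -metric_phiC phi_xi metric0l oppr0.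
rewrite !metricE xi_phi !CinfE mulr1 mulr0 subr0.
by move/esym/eqP; rewrite !mulf_eq0 (negPf Ap0) (negPf l0) => /eqP.
Qed.

End contact_metric_structure.

Theorem corollary4p5 (R : realType) (n : nat) (M : manifold R (2 * n).+1)
    (C : contact_metric M) (D : connection M) :
  (1 <= n)%N -> levi_civita (gm C) D ->
  (phi_recurrent C D /\ constant_curvature (gm C) D) <->
  ((2 * n).+1 = 3%N /\ flat D).
Proof.
move=> n_gt0 LC; split=> [[rec cc]|[n1 flatD]].
  have flatD := recurrent_constant_curvature_flat LC n_gt0 rec cc.
  split=> //; have := flat_dim_le LC flatD.
  by case: n n_gt0 {M C D LC rec cc flatD} => [|[|]].
have cc : constant_curvature (gm C) D.
  by exists 0 => X Y Z; rewrite flatD !scale0r subrr.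
(* Both sides of the recurrence are zero here, so any non-zero form serves; eta(xi) = 1 is non-zero
   because [M] has a point. *)
split=> //; exists (eta C); split=> [|X Y Z W].
  exists (xi C); rewrite eta_xi; have [p _] := manifold_nonempty M.
  apply/eqP => /(congr1 (fun f : Cinf M => f p)); rewrite !CinfE => /eqP.
  by rewrite oner_eq0.
by rewrite (nabla_curv_constant_curvature LC) // !phi0 flatD scaler0.
Qed.
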